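(* Let $n$ be a positive integer, let $p$ be an odd prime with $p\nmid n$, and let $\Phi=T_{4n}\times C_p$. Then the total number of subgroups of $\Phi$ is $$\tau(p)\bigl(\tau(2n)+\sigma(n)\bigr).$$
   Context: $T_{4n}$ denotes the dicyclic group of order $4n$, $T_{4n}=\langle \alpha,\beta \mid \alpha^{2n}=e,\ \alpha^n=\beta^2,\ \beta\alpha\beta^{-1}=\alpha^{-1}\rangle$ (for $n=1$ this is cyclic of order 4). $C_p$ is the cyclic group of order $p$. $\tau(x)$ is the number of positive divisors of $x$ and $\sigma(x)$ is the sum of the positive divisors of $x$. *)

(* Defs.v *)
From mathcomp Require Import all_boot all_fingroup all_solvable.

Set Implicit Arguments.
Unset Strict Implicit.
Unset Printing Implicit Defensive.

Local Open Scope group_scope.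

(* [G \isog Grp (...)] identifies G with the largest finite quotient of the    *)
(* presented group; for n > 0 the presented group is itself finite, of order   *)
(* 4n, so G is that group up to isomorphism.                                   *)
Definition dicyclic (n : nat) (gT : finGroupType) (G : {group gT}) : Prop :=
  G \isog Grp (a : b :
    a ^+ (2 * n)%N = 1, a ^+ n = b ^+ 2, b * a * b^-1 = a^-1).

Definition tau (m : nat) : nat := size (divisors m).

Definition sigma (m : nat) : nat := \sum_(d <- divisors m) d.

(* Main.v *)
(** Since T and C have coprime orders, every subgroup of T x C is the product
    of its projections, so the count is multiplicative, and the subgroups of C
    contribute tau p.  In T, the cyclic group A = <x> of order 2n has index 2
    and every z outside A satisfies z^2 = x^n.  The subgroups inside A
    contribute tau (2n).  A subgroup H not inside A is the union of K and Kz,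
    where z is outside A and the intersection K of H and A contains x^n; for
    fixed K, each of the #|A : K| cosets of K in T \ A arises exactly once, and
    #|A : K| runs over the divisors of n.  That x really has order 2n follows
    from a model of the presentation. *)

Require Import Defs.
From mathcomp Require Import all_boot all_fingroup all_solvable.
From mathcomp Require Import ssralg zmodp.

Set Implicit Arguments.
Unset Strict Implicit.
Unset Printing Implicit Defensive.

Local Open Scope group_scope.

(** * Subgroups of cyclic groups *)

Section Counting.
Variable gT : finGroupType.
Implicit Types G H K A T : {group gT}.

(** A subgroup of a cyclic group is determined by its order, hence by its index. The form [perm_eq]
    serves both to count subgroups and to sum their indices. *)
Lemma perm_index_subgroups G :
  cyclic G ->
  perm_eq [seq #|G : H| | H : {group gT} <- enum (subgroups G)] (divisors #|G|).
Proof.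
move=> cycG; have [x defG] := cyclicP cycG.
apply: uniq_perm (divisors_uniq _) _.
  rewrite map_inj_in_uniq ?enum_uniq // => H K.
  rewrite !mem_enum !inE => sHG sKG eq_index.
  apply/val_inj/eqP; rewrite /= (eq_subG_cyclic cycG) //.
  by rewrite -(eqn_pmul2r (indexg_gt0 G H)) {2}eq_index !Lagrange.
move=> d; rewrite -dvdn_divisors ?cardG_gt0 //.
apply/mapP/idP=> [[H _ ->]|d_dvd]; first exact: dvdn_indexg.
(* The power [x ^+ d] has order [#|G| %/ d], so it generates a subgroup of index [d]. *)
have sxG : <[x ^+ d]> \subset G by rewrite defG cycleX.
exists <[x ^+ d]>%G; first by rewrite mem_enum inE.
rewrite -divgS //= -orderE orderXdiv; last by rewrite orderE -defG.
by rewrite orderE -defG divnA // mulKn.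
Qed.

Lemma card_subgroups_cyclic G : cyclic G -> #|subgroups G| = tau #|G|.
Proof.
by move/perm_index_subgroups/perm_size; rewrite size_map -cardE.
Qed.

(** * Groups with a cyclic subgroup of index 2 *)

Section Index2.
Variables (A T : {group gT}) (u : gT).
Hypotheses (cycA : cyclic A) (sAT : A \subset T) (indexA : #|T : A| = 2).
Hypothesis sqrA' : {in T :\: A, forall z, z ^+ 2 = u}.

Lemma index2_mulVg z w : z \in T :\: A -> w \in T :\: A -> w * z^-1 \in A.
Proof.
by move=> zT wT; rewrite -mem_rcoset (rcoset_index2 sAT indexA).
Qed.

Lemma index2_mulg z w : z \in A -> w \in T :\: A -> z * w \in T :\: A.
Proof.
move=> zA; rewrite !inE => /andP[wA wT].
by rewrite groupMl // wA groupM // (subsetP sAT).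
Qed.

(** [K] is characteristic in the cyclic group [A], which is normal in [T] because its index is 2. *)
Lemma index2_norm K z : K \subset A -> z \in T -> z \in 'N(K).
Proof.
move=> sKA; apply: subsetP; apply: normal_norm.
apply: char_normal_trans (index2_normal sAT indexA).
by rewrite sub_cyclic_char.
Qed.

(** Closure holds because [z] normalizes [K] and [z ^+ 2 = u] lies in [K]: a product of two elements
    of [K :* z] falls back into [K]. *)
Lemma index2_extension_group_set K z :
  K \subset A -> u \in K -> z \in T :\: A -> group_set (K :|: K :* z).
Proof.
move=> sKA uK zTA; have /setDP[zT zA] := zTA.
have nKz := index2_norm sKA zT.
have zz : z * z \in K by rewrite -expg2 sqrA'.
apply/group_setP; split=> [|x y]; first by rewrite inE group1.
have Kz k : k \in K -> z * k * z^-1 \in K.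
  move=> kK; rewrite -[z * k * _]mulgA -[z in z * _]invgK -conjgE.
  by rewrite memJ_norm ?groupV.
rewrite !inE !mem_rcoset => /orP[xK|xK] /orP[yK|yK].
- by rewrite groupM.
- by apply/orP; right; rewrite -mulgA groupM.
- have -> : x * y * z^-1 = (x * z^-1) * (z * y * z^-1).
    by rewrite !mulgA mulgKV.
  by rewrite orbC groupM // Kz.
have -> : x * y = (x * z^-1) * (z * (y * z^-1) * z^-1) * (z * z).
  by rewrite !mulgA !mulgKV.
by rewrite groupM // groupM // Kz.
Qed.

(** For fixed [K], the map sending [H] to [H :\: A] is a bijection onto the right cosets of [K] in
    [T] that do not lie in [A]. There are [#|T : K| - #|A : K|] of these, and [#|T : K|] is twice
    [#|A : K|]. *)
Lemma card_subgroups_extending K :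
    K \subset A -> u \in K ->
  #|[set H : {group gT} | [&& H \subset T, ~~ (H \subset A)
                            & (H :&: A)%G == K]]| = #|A : K|.
Proof.
move=> sKA uK; set S := [set H | _].
have indexK : #|rcosets K T :\: rcosets K A| = #|A : K|.
  rewrite cardsD (setIidPr _) ?imsetS //.
  rewrite -[#|rcosets K T|]/#|T : K| -[#|rcosets K A|]/#|A : K|.
  by rewrite -(Lagrange_index sAT sKA) indexA mul2n -addnn addnK.
have defS H : H \in S ->
    exists2 z, z \in T :\: A & H :=: K :|: K :* z /\ H :\: A = K :* z.
  rewrite !inE => /and3P[sHT /subsetPn[z zH zA] /eqP defK].
  have zTA : z \in T :\: A by rewrite inE zA (subsetP sHT).
  exists z => //; suff HA : H :\: A = K :* z by rewrite -HA -defK setID.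
  apply/setP=> w; rewrite inE mem_rcoset -defK inE.
  apply/andP/andP=> [[wA wH]|[wzH wzA]].
    by rewrite groupM ?groupV // index2_mulVg // inE wA (subsetP sHT).
  rewrite -(groupMl _ wzA) mulgKV in zA.
  by rewrite zA -(mulgKV z w) groupM.
rewrite -indexK -(card_in_imset (f := fun H => H :\: A) (D := mem S));
  last first.
  move=> H1 H2 /defS[z1 _ [eH1 eA1]] /defS[z2 _ [eH2 eA2]] eqA.
  by apply: val_inj; rewrite /= eH1 eH2 -eA1 -eA2 eqA.
apply: eq_card => B; apply/imsetP/setDP=> [[H /defS[z zTA [_ ->]] ->]|].
  have /setDP[zT zA] := zTA; split; first by apply/rcosetsP; exists z.
  apply: contra zA => /rcosetsP[a aA eqKz].
  have: z \in K :* a by rewrite -eqKz rcoset_refl.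
  by rewrite mem_rcoset => /(subsetP sKA); rewrite groupMr ?groupV.
case=> /rcosetsP[z zT ->] KzA.
have zTA : z \in T :\: A.
  by rewrite inE zT andbT; apply: contra KzA => zA; apply/rcosetsP; exists z.
have KzTA : K :* z \subset T :\: A.
  apply/subsetP=> w; rewrite mem_rcoset => wK.
  by rewrite -(mulgKV z w) index2_mulg // (subsetP sKA).
have [_ disjKz] := subsetDP KzTA.
exists (group (index2_extension_group_set sKA uK zTA)) => /=; last first.
  rewrite setDUl; have -> : K :\: A = set0 by apply/eqP; rewrite setD_eq0.
  by rewrite set0U; apply/esym/setDidPl.
rewrite inE /= subUset (subset_trans sKA) //=.
rewrite (subset_trans KzTA (subsetDl _ _)) /= subUset sKA /=.
apply/andP; split.
  by apply/subsetPn; exists z; rewrite ?rcoset_refl //; case/setDP: zTA.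
apply/eqP/val_inj; rewrite /= setIUl (setIidPl sKA).
by rewrite (disjoint_setI0 disjKz) setU0.
Qed.

Lemma card_subgroups_index2 :
  #|subgroups T| =
    #|subgroups A| + \sum_(K in subgroups A | u \in K) #|A : K|.
Proof.
rewrite -(cardsID (subgroups A)) (setIidPr _); last first.
  by apply/subsetP=> H; rewrite !inE => /subset_trans->.
congr (_ + _)%N; rewrite -sum1_card.
rewrite (partition_big (fun H => (H :&: A)%G)
  (fun K => (K \in subgroups A) && (u \in K))) /=; last first.
  move=> H; rewrite !inE subsetIr /= => /andP[/subsetPn[z zH zA] sHT].
  have zTA : z \in T :\: A by rewrite inE zA (subsetP sHT).
  (* [u = z * z] lies in [A]: read it as [z * (z^-1)^-1], a quotient of two elements outside [A]. *)
  rewrite -(sqrA' zTA) groupX //= expg2 -[z in _ * z]invgK.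
  by rewrite index2_mulVg // !inE groupV zA groupV (subsetP sHT).
apply: eq_bigr => K /andP[]; rewrite inE => sKA uK.
rewrite sum1_card -(card_subgroups_extending sKA uK).
by apply: eq_card => H; rewrite [LHS]unfold_in !inE -andbA andbCA.
Qed.
End Index2.
End Counting.

(** * Subgroups of direct products of coprime order *)

Lemma subgroups_setX_coprime (gT rT : finGroupType) (G : {group gT})
    (H : {group rT}) :
  coprime #|G| #|H| ->
  subgroups (setX G H) =
    [set setX_group KL.1 KL.2 | KL in setX (subgroups G) (subgroups H)].
Proof.
move=> coGH; apply/setP=> M; rewrite inE; apply/idP/imsetP; last first.
  by case=> -[K L] /setXP[]; rewrite !inE /= => sKG sLH ->; apply: setXS.
have expX (x : gT) (y : rT) k : (x, y) ^+ k = (x ^+ k, y ^+ k).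
  by elim: k => [|k IHk]; rewrite ?expg0 // !expgS IHk.
have split_cards k l : exists e, e = k %[mod #|G|] /\ e = l %[mod #|H|].
  by exists (chinese #|G| #|H| k l); rewrite chinese_modl ?chinese_modr.
move=> sM; have components x y : (x, y) \in M -> (x, 1) \in M /\ (1, y) \in M.
  move=> xyM; have /setXP[xG yH] := subsetP sM _ xyM.
  (* By the Chinese remainder theorem, [(x, y) ^+ e = (x, 1)] and [(x, y) ^+ f = (1, y)]. *)
  have [e [eG eH]] := split_cards 1%N 0%N.
  have [f [fG fH]] := split_cards 0%N 1%N.
  have powG k : x ^+ k = x ^+ (k %% #|G|) by rewrite expg_mod ?expg_cardG.
  have powH k : y ^+ k = y ^+ (k %% #|H|) by rewrite expg_mod ?expg_cardG.
  split; [have := groupX e xyM | have := groupX f xyM]; rewrite expX.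
    by rewrite powG powH eG eH -powG -powH.
  by rewrite powG powH fG fH -powG -powH.
exists ([group of fst @* M], [group of snd @* M]).
  apply/setXP; rewrite !inE; split; apply/subsetP=> z /morphimP[[x y] _ xyM ->].
    by case/setXP: (subsetP sM _ xyM).
  by case/setXP: (subsetP sM _ xyM).
apply/val_inj/setP=> -[x y]; rewrite /= in_setX.
apply/idP/andP=> [xyM|].
  split; first by apply: (mem_morphim (fst_morphism _ _)) xyM; rewrite inE.
  by apply: (mem_morphim (snd_morphism _ _)) xyM; rewrite inE.
case=> /morphimP[[x1 y1] _ M1 /= ->] /morphimP[[x2 y2] _ M2 /= ->].
have [xM _] := components _ _ M1; have [_ yM] := components _ _ M2.
have -> : (x1, y2) = (x1, 1) * (1, y2) :> gT * rT.
  by congr pair; rewrite ?mulg1 ?mul1g.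
exact: groupM.
Qed.

Lemma card_subgroups_setX (gT rT : finGroupType) (G : {group gT})
    (H : {group rT}) :
  coprime #|G| #|H| ->
  #|subgroups (setX G H)| = (#|subgroups G| * #|subgroups H|)%N.
Proof.
move=> coGH; rewrite subgroups_setX_coprime // -cardsX card_in_imset //.
move=> [K1 L1] [K2 L2] _ _ /= /(congr1 val) /= eqX.
have eqKL x y : ((x \in K1) && (y \in L1)) = ((x \in K2) && (y \in L2)).
  by move/setP/(_ (x, y)): eqX; rewrite !inE.
congr pair; apply/val_inj/setP=> x /=.
  by have := eqKL x 1; rewrite !group1 !andbT.
by have := eqKL 1 x; rewrite !group1.
Qed.

(** * A permutation model of the dicyclic presentation *)

(** [rot] and [flip] are the generators of the dicyclic group in its regular
    representation, (k, s) standing for a^k b^s. *)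
Section Model.
Variable n : nat.
Hypothesis n_gt0 : 0 < n.
Local Notation Z2n := 'Z_(2 * n).
Local Notation point := (Z2n * bool)%type.
Implicit Types (z : point) (i : nat).

Let n2_gt1 : 1 < 2 * n.
Proof. by rewrite mul2n -addnn -[2]/(1 + 1)%N leq_add. Qed.

Let natr2n : (n%:R + n%:R = 0 :> Z2n)%R.
Proof. by apply/val_inj; rewrite -GRing.natrD addnn -mul2n pchar_Zp. Qed.

(** Right multiplication by a, using b a = a^-1 b; [flip_fun] is right multiplication by b, using
    b^2 = a^n. *)
Definition rot_fun z : point := (if z.2 then z.1 - 1 else z.1 + 1, z.2)%R.

Definition flip_fun z : point := (if z.2 then z.1 + n%:R else z.1, ~~ z.2)%R.

Lemma rot_fun_inj : injective rot_fun.
Proof.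
move=> [x s] [y t] eq_xy; have /= eq_st := congr1 snd eq_xy.
have /= := congr1 fst eq_xy; rewrite -eq_st.
by case: s {eq_xy eq_st} => /GRing.addIr->.
Qed.

Lemma flip_fun_inj : injective flip_fun.
Proof.
move=> [x s] [y t] eq_xy; have /= /negb_inj eq_st := congr1 snd eq_xy.
have /= := congr1 fst eq_xy; rewrite -eq_st.
by case: s {eq_xy eq_st} => [/GRing.addIr|] ->.
Qed.

Definition rot := perm rot_fun_inj.
Definition flip := perm flip_fun_inj.

Lemma rotX i z :
  (rot ^+ i) z = (if z.2 then z.1 - i%:R else z.1 + i%:R, z.2)%R.
Proof.
case: z => x s; elim: i => [|i IHi] /=.
  by rewrite perm1 GRing.subr0 GRing.addr0 if_same.
rewrite expgSr permM IHi permE /rot_fun /= -GRing.natr1.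
by case: s {IHi}; rewrite ?GRing.opprD GRing.addrA.
Qed.

Lemma rot_pow_order : rot ^+ (2 * n) = 1.
Proof.
apply/permP=> -[x s]; rewrite rotX perm1 /= pchar_Zp //.
by rewrite GRing.subr0 GRing.addr0 if_same.
Qed.

Lemma rot_pow_flip : rot ^+ n = flip ^+ 2.
Proof.
apply/permP=> -[x s]; rewrite rotX expgS expg1 permM !permE /flip_fun /=.
case: s => //=.
by rewrite -[in LHS](GRing.addr0 x) -natr2n GRing.addrA GRing.addrK.
Qed.

Lemma rot_conj_flip : flip * rot * flip^-1 = rot^-1.
Proof.
apply: (mulIg flip); rewrite mulgKV; apply: (mulgI rot); rewrite mulKVg.
apply/permP=> -[x s]; rewrite !permM !permE /flip_fun /rot_fun /=.
by case: s; rewrite /= ?GRing.addrK // GRing.addrAC GRing.subrK.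
Qed.

Lemma rot_order_dvd : 2 * n %| #[rot].
Proof.
(* [rot ^+ i] moves the identity point to [(i%:R, false)], so fixing it forces [2 * n] to divide
   [i]. *)
have /permP/(_ (0%R, false)) := expg_order rot.
rewrite rotX perm1 /= GRing.add0r => -[/(congr1 val)].
by rewrite /= val_Zp_nat // => /eqP.
Qed.

Lemma flip_notin_rot : flip \notin <[rot]>.
Proof.
apply/negP=> /cycleP[i /permP/(_ (0%R, false))].
by rewrite rotX permE.
Qed.

Lemma card_rot_flip : 4 * n <= #|<[rot]> <*> <[flip]>|.
Proof.
have sR := joing_subl <[rot]> <[flip]>.
rewrite -(Lagrange sR) -[4]/(2 * 2)%N -mulnA mulnC leq_mul //.
  by rewrite dvdn_leq ?cardG_gt0 // rot_order_dvd.
rewrite indexg_gt1; apply: contra flip_notin_rot => /subsetP-> //.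
by rewrite mem_gen // inE cycle_id orbT.
Qed.
End Model.

(** * Structure of dicyclic groups *)

(** The relations bound [#[x]] by [2 * n] and the index by 2; the model, a homomorphic image of [T],
    shows that [#|T|] is at least [4 * n], so both bounds are attained. *)
Lemma dicyclic_index2 (n : nat) (gT : finGroupType) (T : {group gT}) :
    0 < n -> dicyclic n T ->
  exists x : gT, [/\ #[x] = (2 * n)%N, <[x]> \subset T, #|T : <[x]>| = 2
                   & {in T :\: <[x]>, forall z, z ^+ 2 = x ^+ n}].
Proof.
move=> n_gt0 dicT.
have card_ge : 4 * n <= #|T|.
  apply: leq_trans (card_rot_flip n_gt0) (leq_homg _).
  rewrite (dicT _ (<[rot n]> <*> <[flip n]>)%G).
  apply/existsP; exists (rot n, flip n); rewrite /= !xpair_eqE eqxx /=.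
  by rewrite rot_pow_order // rot_pow_flip // rot_conj_flip !eqxx.
(* [T] is an image of itself, which yields generators satisfying the relations. *)
have := dicT _ T; rewrite homg_refl => /esym/existsP[[x y]] /=.
rewrite !xpair_eqE => /and4P[/eqP defT /eqP x2n /eqP xn /eqP xy].
have conjyE w : y * w * y^-1 = w ^ y^-1 by rewrite conjgE invgK mulgA.
have nxy : y \in 'N(<[x]>).
  by rewrite -groupV inE -cycleJ -conjyE xy cycleV.
have sxT : <[x]> \subset T by rewrite -defT joing_subl.
have yT : y \in T by rewrite -defT mem_gen // inE cycle_id orbT.
have nxT : T \subset 'N(<[x]>).
  by rewrite -defT join_subG normG cycle_subG.
have order_x : #[x] <= 2 * n.
  by rewrite dvdn_leq ?muln_gt0 // order_dvdn x2n.
have index_le : #|T : <[x]>| <= 2.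
  rewrite -card_quotient // -defT quotientYidl ?cycle_subG // quotient_cycle //.
  rewrite -orderE dvdn_leq // order_dvdn -morphX //= -xn.
  by rewrite coset_id // mem_cycle.
have card_eq : 2 * n * 2 <= #[x] * #|T : <[x]>| by rewrite Lagrange // mulnAC.
have index_eq : #|T : <[x]>| = 2.
  apply/eqP; rewrite eqn_leq index_le -(@leq_pmul2l (2 * n)) ?muln_gt0 //.
  by rewrite (leq_trans card_eq) // leq_mul2r order_x orbT.
have order_eq : #[x] = (2 * n)%N.
  by apply/eqP; rewrite eqn_leq order_x; rewrite index_eq leq_pmul2r in card_eq.
exists x; split=> // z zT.
have yTx : y \in T :\: <[x]>.
  rewrite inE yT andbT; apply/negP=> yx.
  have /joing_idPl eqT : <[y]> \subset <[x]> by rewrite cycle_subG.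
  by rewrite -defT eqT indexgg in index_eq.
move: zT; rewrite -(rcoset_index2 sxT index_eq yTx).
case/rcosetP=> _ /cycleP[i ->] ->.
(* Here [z = x ^+ i * y]; conjugation by [y] inverts [x ^+ i], so the powers of [x] cancel and
   [z ^+ 2 = y ^+ 2]. *)
have inv_xi : y * x ^+ i * y^-1 = (x ^+ i)^-1.
  by rewrite conjyE conjXg -conjyE xy expgVn.
have -> : (x ^+ i * y) ^+ 2 = x ^+ i * (y * x ^+ i * y^-1) * y ^+ 2.
  by rewrite !expg2 !mulgA mulgKV.
by rewrite inv_xi mulgV mul1g xn.
Qed.

(* The final count *)
Local Close Scope group_scope.

Theorem theorem3p2 (n p : nat) (gT rT : finGroupType)
    (T : {group gT}) (C : {group rT}) :
  0 < n -> prime p -> odd p -> ~~ (p %| n) ->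
  dicyclic n T -> cyclic C -> #|C| = p ->
  #|subgroups (setX T C)| = tau p * (tau (2 * n) + sigma n).
Proof.
move=> n_gt0 p_pr p_odd p_n dicT cycC cardC.
have [x [order_x sxT index_x sqr_x]] := dicyclic_index2 n_gt0 dicT.
have cycx := cycle_cyclic x.
have cardT : #|T| = 2 * n * 2.
  by rewrite -(Lagrange sxT) index_x -orderE order_x.
have p_2 : ~~ (p %| 2).
  by rewrite dvdn_prime2 //; apply: contraTneq p_odd => ->.
rewrite card_subgroups_setX; last first.
  rewrite cardT cardC coprime_sym prime_coprime // !Euclid_dvdM //.
  by rewrite !negb_or p_2 p_n.
rewrite (card_subgroups_cyclic cycC) cardC mulnC; congr (_ * _).
rewrite (card_subgroups_index2 cycx sxT index_x sqr_x).
rewrite card_subgroups_cyclic // -orderE order_x; congr (_ + _).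
have n2_gt0 : 0 < 2 * n by rewrite muln_gt0.
have order_xn : #[x ^+ n]%g = 2.
  by rewrite orderXdiv order_x ?dvdn_mull // mulnK.
(* In a cyclic group, [K] contains [x ^+ n], of order 2, iff [#|K|] is even. As [#|K|] times the
   index of [K] is [2 * n], this says that the index divides [n]. *)
transitivity (\sum_(K <- enum (subgroups <[x]>%g) | #|<[x]> : K|%g %| n)
                #|<[x]> : K|%g).
  rewrite big_enum_cond; apply: eq_bigl => K; rewrite inE.
  case sKx: (K \subset <[x]>%g) => //=.
  rewrite -cycle_subG -(cardSg_cyclic cycx) ?cycleX // -orderE order_xn.
  rewrite -[RHS](dvdn_pmul2l (cardG_gt0 K)) Lagrange //.
  by rewrite -orderE order_x dvdn_pmul2r.
(* The indices run once through the divisors of [2 * n]; those dividing [n] are exactly the divisors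
   of [n], with sum [sigma n]. *)
rewrite -(big_map (fun K : {group gT} => #|<[x]> : K|%g) (fun d => d %| n) id).
rewrite (perm_big _ (perm_index_subgroups cycx)) -orderE order_x -big_filter.
apply/perm_big/uniq_perm; rewrite ?filter_uniq ?divisors_uniq // => d.
rewrite mem_filter -!dvdn_divisors // andb_idr //.
by move/dvdn_mull.
Qed.
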